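(* Let $\{e_1,\dots,e_r\}$ be a set of (distinct) primitive idempotents of $R=\mathbb{F}_q[H]$, let $e=e_1+e_2+\dots+e_r$, and let $k_j=\dim_{\mathbb{F}_q}(Re_j)$ for $j=1,\dots,r$. Let $\mathfrak{C}$ denote the set of all $1$-generator $H$-quasi-abelian codes in $\mathbb{F}_q[G]$ with idempotent generator $e$. Then there exists a one-to-one correspondence between $[\Omega]$ and $\mathfrak{C}$. Hence, the number of $1$-generator $H$-quasi-abelian codes in $\mathbb{F}_q[G]$ having $e$ as their idempotent generator is $$\prod_{j=1}^r \frac{q^{lk_j}-1}{q^{k_j}-1}.$$
   Context: Let $\mathbb{F}_q$ be a finite field with $q$ elements, $G$ a finite abelian group (written additively), $H\le G$ a subgroup of index $l=[G:H]$, with $\gcd(q,|H|)=1$. Group ring elements are written $\sum_g \alpha_g Y^g$. Let $R=\mathbb{F}_q[H]$ and $S=\mathbb{F}_{q^l}[H]\supseteq R$. An idempotent is a nonzero element $e$ with $e^2=e$; an idempotent $e$ is primitive if for every other idempotent $f$ either $ef=e$ or $ef=0$. An $H$-quasi-abelian code in $\mathbb{F}_q[G]$ is an $R$-submodule of $\mathbb{F}_q[G]$; it is of $1$-generator if it is a cyclic $R$-module. Fix representatives $\mathfrak{g}_1,\dots,\mathfrak{g}_l$ of the cosets of $H$ in $G$. The map $\Phi:\mathbb{F}_q[G]\to R^l$, $\Phi\left(\sum_{h\in H}\sum_{i=1}^l \alpha_{h+\mathfrak{g}_i}Y^{h+\mathfrak{g}_i}\right)=\left(\sum_{h\in H}\alpha_{h+\mathfrak{g}_1}Y^h,\dots,\sum_{h\in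 H}\alpha_{h+\mathfrak{g}_l}Y^h\right)$, is an $R$-module isomorphism, through which $1$-generator $H$-quasi-abelian codes are identified with cyclic submodules $R\boldsymbol{a}\subseteq R^l$, $\boldsymbol{a}=(a_1,\dots,a_l)\in R^l$. The idempotent generator of $R\boldsymbol{a}$ (and of the corresponding code) is the idempotent $e\in R$ with $Re=Ra_1+Ra_2+\dots+Ra_l$. For a ring $\mathcal{R}$ (or an ideal), $\mathcal{R}^*$ is its set of nonzero elements; $(Re_j)^\times$ is the group of units of the ring $Re_j$ (whose identity is $e_j$). On $(Se_j)^*$ define the equivalence relation $A\sim B$ iff there is $u\in(Re_j)^\times$ with $A=uB$. Let $[A]$ be the class of $A$, $[(Se_j)^*]=\{[A]\mid A\in (Se_j)^*\}$, and $[\Omega]=\prod_{j=1}^r[(Se_j)^*]$ (Cartesian product). *)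

(* Defs.v *)
From HB Require Import structures.
From mathcomp Require Import all_boot all_order all_algebra all_fingroup.

Set Implicit Arguments.
Unset Strict Implicit.
Unset Printing Implicit Defensive.

Import GRing.Theory.
Local Open Scope ring_scope.

(* Group algebra K[gT]: x : {galg K[gT]} stands for \sum_g x g . Y^g, with the
   group law of gT (written multiplicatively, as always for a finGroupType) in
   the exponents.  {ffun gT -> K} itself carries the pointwise product; the
   alias is what selects the convolution product instead. *)
Definition galg (K : Type) (gT : finGroupType) : Type := {ffun gT -> K}.

Notation "{ 'galg' K [ gT ] }" := (galg K gT)
  (at level 0, K at level 2, gT at level 200, format "{ 'galg'  K [ gT ] }")
  : type_scope.

HB.instance Definition _ (K : eqType) gT :=
  Equality.copy {galg K[gT]} {ffun gT -> K}.
HB.instance Definition _ (K : choiceType) gT :=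
  Choice.copy {galg K[gT]} {ffun gT -> K}.
HB.instance Definition _ (K : countType) gT :=
  Countable.copy {galg K[gT]} {ffun gT -> K}.
HB.instance Definition _ (K : finType) gT :=
  Finite.copy {galg K[gT]} {ffun gT -> K}.
HB.instance Definition _ (K : zmodType) gT :=
  GRing.Zmodule.copy {galg K[gT]} {ffun gT -> K}.

Section GroupAlgebraRing.

Variables (K : nzRingType) (gT : finGroupType).
Implicit Types x y z : {galg K[gT]}.

HB.instance Definition _ := GRing.Lmodule.copy {galg K[gT]} {ffun gT -> K^o}.
HB.instance Definition _ := Vector.copy {galg K[gT]} {ffun gT -> K^o}.

Definition galg_mul x y : {galg K[gT]} :=
  [ffun g => \sum_h x h * y (h^-1 * g)%g].
Definition galg_one : {galg K[gT]} := [ffun g => (g == 1%g)%:R].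

Fact galg_mulA : associative galg_mul.
Proof.
move=> x y z; apply/ffunP=> g; rewrite !ffunE.
under eq_bigr => h _ do rewrite ffunE mulr_sumr.
under [RHS]eq_bigr => h _ do rewrite ffunE mulr_suml.
rewrite [RHS]exchange_big /=; apply: eq_bigr => k _.
rewrite (reindex_inj (mulgI k^-1%g)) /=; apply: eq_bigr => h _.
by rewrite mulrA invMg invgK -mulgA mulKVg.
Qed.

Fact galg_mul1l : left_id galg_one galg_mul.
Proof.
move=> x; apply/ffunP=> g; rewrite ffunE (bigD1 1%g) //= big1 => [|h h1].
  by rewrite ffunE eqxx mul1r invg1 mul1g addr0.
by rewrite ffunE (negPf h1) mul0r.
Qed.

Fact galg_mul1r : right_id galg_one galg_mul.
Proof.
move=> x; apply/ffunP=> g; rewrite ffunE (bigD1 g) //= big1 => [|h hg].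
  by rewrite ffunE mulVg eqxx mulr1 addr0.
by rewrite ffunE -eq_mulVg1 (negPf hg) mulr0.
Qed.

Fact galg_mulDl : left_distributive galg_mul +%R.
Proof.
move=> x y z; apply/ffunP=> g; rewrite !ffunE -big_split /=.
by apply: eq_bigr => h _; rewrite ffunE mulrDl.
Qed.

Fact galg_mulDr : right_distributive galg_mul +%R.
Proof.
move=> x y z; apply/ffunP=> g; rewrite !ffunE -big_split /=.
by apply: eq_bigr => h _; rewrite ffunE mulrDr.
Qed.

Fact galg_oner_neq0 : galg_one != 0.
Proof. by apply/eqP=> /ffunP/(_ 1%g)/eqP; rewrite !ffunE eqxx oner_eq0. Qed.

HB.instance Definition _ := GRing.Zmodule_isNzRing.Build {galg K[gT]}
  galg_mulA galg_mul1l galg_mul1r galg_mulDl galg_mulDr galg_oner_neq0.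

Lemma galgZ (a : K) x g : (a *: x) g = a * x g.
Proof. exact: ffunE. Qed.

Lemma galgM x y g : (x * y) g = \sum_h x h * y (h^-1 * g)%g.
Proof. exact: ffunE. Qed.

Lemma galg1 g : (1 : {galg K[gT]}) g = (g == 1%g)%:R.
Proof. exact: ffunE. Qed.

Fact galg_scaleAl (a : K) x y : a *: (x * y) = (a *: x) * y.
Proof.
apply/ffunP=> g; rewrite galgZ !galgM mulr_sumr.
by apply: eq_bigr => h _; rewrite galgZ mulrA.
Qed.

HB.instance Definition _ :=
  GRing.Lmodule_isLalgebra.Build K {galg K[gT]} galg_scaleAl.

End GroupAlgebraRing.

HB.instance Definition _ (K : finNzRingType) gT :=
  GRing.NzRing.on {galg K[gT]}.

Lemma galgMC (K : comNzRingType) (gT : finGroupType) (x y : {galg K[gT]}) :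
  abelian [set: gT] -> x * y = y * x.
Proof.
move=> /centsP cGG; apply/ffunP=> g; rewrite !galgM.
rewrite (reindex_inj invg_inj) /= (reindex_inj (mulIg g^-1%g)) /=.
apply: eq_bigr => h _; rewrite invgK mulgKV invMg invgK mulrC.
by rewrite (cGG g _ h^-1%g) ?inE.
Qed.

(* The inclusion K[H] -> L[H] induced by a coefficient embedding K -> L *)
Definition galg_ext (K L : Type) (gT : finGroupType) (iota : K -> L)
  (x : {galg K[gT]}) : {galg L[gT]} := [ffun g => iota (x g)].

Section Idempotents.

Variable R : finNzRingType.
Implicit Types e f x : R.

Definition idempotent_elt e := (e != 0) && (e * e == e).

Definition primitive_idempotent e :=
  idempotent_elt e &&
  [forall f, idempotent_elt f && (f != e) ==> (e * f == e) || (e * f == 0)].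

Definition principal x : {set R} := [set z * x | z : R].

(* Units of the ring R e, whose identity is e *)
Definition corner_units e : {set R} :=
  [set u in principal e | [exists v in principal e, (u * v == e) && (v * u == e)]].

(* R a_1 + ... + R a_l *)
Definition sum_principal l (a : 'rV[R]_l) : {set R} :=
  [set \sum_i b 0 i * a 0 i | b : 'rV[R]_l].

Definition cyclic_submod l (a : 'rV[R]_l) : {set 'rV[R]_l} :=
  [set z *: a | z : R].

End Idempotents.

Section QuasiAbelianCodes.

Variables (F : finFieldType) (gT : finGroupType) (H : {group gT}).
Local Notation R := {galg F[[subg H]]}.
Local Notation FG := {galg F[gT]}.

(* The inclusion F[H] -> F[G] (extension by 0), through which F[G] is an
   F[H]-module *)
Definition galg_incl (x : R) : FG :=
  [ffun g => if g \in H then x (subg H g) else 0].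

Definition quasi_abelian (C : {set FG}) :=
  [&& 0 \in C,
      [forall c in C, forall d in C, c + d \in C] &
      [forall x : R, forall c in C, galg_incl x * c \in C]].

Definition one_generator (C : {set FG}) :=
  [exists c : FG, C == [set galg_incl x * c | x : R]].

Definition coset_reps l (g : 'I_l -> gT) :=
  injective (fun i => H :* g i)%g /\
  [set (H :* g i)%g | i : 'I_l] = rcosets H [set: gT].

Definition Phi l (g : 'I_l -> gT) (c : FG) : 'rV[R]_l :=
  \row_i [ffun h : [subg H] => c (sgval h * g i)%g].

Definition idempotent_generator l (g : 'I_l -> gT) (C : {set FG}) (e : R) :=
  [exists a : 'rV[R]_l,
    [&& Phi g @: C == cyclic_submod a, idempotent_elt e &
        principal e == sum_principal a]].

Definition qa_codes l (g : 'I_l -> gT) (e : R) : {set {set FG}} :=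
  [set C | [&& quasi_abelian C, one_generator C & idempotent_generator g C e]].

End QuasiAbelianCodes.

Section Classes.

Variables (F L : finFieldType) (iota : F -> L) (hT : finGroupType).
Local Notation R := {galg F[hT]}.
Local Notation S := {galg L[hT]}.

Definition unit_assoc (e : R) : rel S :=
  fun A B => [exists u in corner_units e, A == galg_ext iota u * B].

(* [(S e)^*] *)
Definition unit_classes (e : R) : {set {set S}} :=
  equivalence_partition (unit_assoc e) (principal (galg_ext iota e) :\ 0).

End Classes.

(* Main.v *)
Require Import Defs.
From HB Require Import structures.
From mathcomp Require Import all_boot all_order all_algebra all_fingroup.
From mathcomp Require Import cyclic finfield mxabelem.

(** Both halves of the theorem come down to two orbit counts.

    The map Phi identifies the codes with the cyclic submodules R a of R^l whose
    entries satisfy R a_1 + ... + R a_l = R e.  Two such rows a, b span the same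
    submodule exactly when b = u a for a unit u of the ring R e, and u is then
    unique, so the number of codes times the number of units of R e is the
    number of rows that generate R e (card_cyclic_submods).

    The ring R = F[H] is von Neumann regular: since the characteristic p is
    prime to the order of H, h |-> h^p permutes H, hence x |-> x^p, which sends
    the coefficient a of h to the coefficient a^p of h^p, is injective on the
    finite ring R, and some iterate fixes x (galg_regular).  A nonzero element
    of R e_j therefore has a power which is a nonzero idempotent of R e_j, i.e.
    e_j itself, and R e_j is a field (primitive_corner_field).  Distinct
    primitive idempotents being orthogonal, R e is the product of the fields
    R e_j, and a row generates R e exactly when each of its r components is a
    nonzero row over R e_j.  With n_j the cardinal of R e_j, there are
    prod_j (n_j^l - 1) such rows; the units of R e are the rows of length one,
    and number prod_j (n_j - 1) (card_gen_rows).

    On the other side, the rank of a matrix does not change under extension of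
    the base field, so S e_j has n_j^l elements (card_principal_ext).  The units
    of the field R e_j act freely on the nonzero ones, and the number of classes
    is (n_j^l - 1) / (n_j - 1) (card_unit_classes).  So the product of the class
    sets has as many elements as the set of codes, which yields the one-to-one
    correspondence, and n_j = q^(k_j) gives the formula. *)

Set Implicit Arguments.
Unset Strict Implicit.
Unset Printing Implicit Defensive.

Import GRing.Theory.
Local Open Scope ring_scope.

(** * Counting in finite sets *)

Lemma card_uniform_imset (aT rT : finType) (A : {set aT}) (f : aT -> rT) n :
  (forall a, a \in A -> #|[set b in A | f b == f a]| = n) ->
  #|A| = (#|f @: A| * n)%N.
Proof.
move=> fib; rewrite -sum1_card (partition_big_imset f) /= -sum_nat_const.
apply: eq_bigr => _ /imsetP[a Aa ->].
by rewrite -(fib a Aa) -sum1_card; apply: eq_bigl => b; rewrite !inE.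
Qed.

Lemma equicardinal_bij (aT rT : finType) (y0 : rT) (A : {set aT})
    (B : {set rT}) :
  #|A| = #|B| ->
  exists f : aT -> rT, {in A &, injective f} /\ [set f a | a in A] = B.
Proof.
move=> eqAB; pose f a := nth y0 (enum B) (index a (enum A)).
have ltB a : a \in A -> (index a (enum A) < size (enum B))%N.
  by move=> Aa; rewrite -cardE -eqAB cardE index_mem mem_enum.
have injf : {in A &, injective f}.
  move=> a b Aa Ab /eqP; rewrite nth_uniq ?enum_uniq ?ltB // => /eqP.
  by apply: (@index_inj _ a (enum A)); rewrite mem_enum.
exists f; split=> //; apply/eqP; rewrite eqEcard card_in_imset // eqAB leqnn.
rewrite andbT; apply/subsetP=> _ /imsetP[a Aa ->].
by rewrite -mem_enum mem_nth ?ltB.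
Qed.

Lemma card_rV_in (T : finType) (X : {set T}) l :
  #|[set b : 'rV[T]_l | [forall i, b 0 i \in X]]| = (#|X| ^ l)%N.
Proof.
rewrite -[l in RHS]card_ord -card_ffun_on.
pose f (b : {ffun 'I_l -> T}) : 'rV[T]_l := \row_i b i.
rewrite -[RHS](card_imset (f := f)) => [|b c /rowP eqbc]; last first.
  by apply/ffunP=> i; have := eqbc i; rewrite !mxE.
apply: eq_card => b; rewrite inE; apply/forallP/imsetP=> [Xb | [c Xc ->] i].
  exists [ffun i => b 0 i]; last by apply/rowP=> i; rewrite mxE ffunE.
  by apply/ffun_onP=> i; rewrite ffunE.
by rewrite mxE; apply: (ffun_onP Xc).
Qed.

(** * Ideals and cyclic submodules over a finite commutative ring *)

Section FiniteCommutativeRing.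

Variable R : finNzRingType.
Hypothesis mulC : commutative (@GRing.mul R).
Implicit Types (e f x y z : R).

Lemma principalP x y : reflect (exists z, y = z * x) (y \in principal x).
Proof.
by apply: (iffP imsetP) => [[z _ ->]|[z ->]]; exists z.
Qed.

Lemma mem_principal e x : e * e = e -> (x \in principal e) = (x * e == x).
Proof.
move=> ee; apply/principalP/eqP=> [[z ->] | <-]; last by exists x.
by rewrite -mulrA ee.
Qed.

Lemma mem_sum_principal l (a : 'rV[R]_l) i : a 0 i \in sum_principal a.
Proof.
apply/imsetP; exists (\row_j (j == i)%:R) => //.
rewrite (bigD1 i) //= mxE eqxx mul1r big1 ?addr0 // => j /negPf ji.
by rewrite mxE ji mul0r.
Qed.

(** The generating rows are the objects counted: they parametrize the cyclic
    submodules, and those of length one are the units of R e. *)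
Definition gen_rows l e : {set 'rV[R]_l} :=
  [set a | principal e == sum_principal a].

Lemma gen_rowsP l e (a : 'rV[R]_l) : e * e = e ->
  reflect ((forall i, a 0 i * e = a 0 i) /\
           exists b : 'rV[R]_l, e = \sum_i b 0 i * a 0 i)
          (a \in gen_rows l e).
Proof.
move=> ee; rewrite inE; apply: (iffP eqP) => [eqea | [ae [b eb]]].
  split=> [i|].
    by apply/eqP; rewrite -mem_principal // eqea mem_sum_principal.
  have /imsetP[b _ ->]: e \in sum_principal a; last by exists b.
  by rewrite -eqea mem_principal ?ee.
apply/setP=> x; rewrite mem_principal //.
apply/eqP/imsetP=> [<- | [c _ ->]].
  exists (x *: b) => //; rewrite eb mulr_sumr.
  by apply: eq_bigr => i _; rewrite mxE mulrA.
by rewrite mulr_suml; apply: eq_bigr => i _; rewrite -mulrA ae.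
Qed.

Lemma corner_unitsP e u : e * e = e ->
  reflect (u * e = u /\ exists v, v * u = e) (u \in corner_units e).
Proof.
move=> ee; rewrite inE mem_principal //.
apply: (iffP andP) => [[/eqP ue /exists_inP[v _ /andP[_ /eqP vu]]] |].
  by split=> //; exists v.
case=> ue [v vu]; split; first exact/eqP.
apply/exists_inP; exists (v * e).
  by rewrite mem_principal // -mulrA ee.
by rewrite [u * _]mulC -mulrA [e * u]mulC ue vu eqxx.
Qed.

Lemma cyclic_submodP l (a b : 'rV[R]_l) :
  reflect (exists z, b = z *: a) (b \in cyclic_submod a).
Proof. by apply: (iffP imsetP) => [[z _ ->]|[z ->]]; exists z. Qed.

Lemma cyclic_submod_sub l (a b : 'rV[R]_l) :
  b \in cyclic_submod a -> cyclic_submod b \subset cyclic_submod a.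
Proof.
case/cyclic_submodP=> z ->; apply/subsetP=> _ /cyclic_submodP[w ->].
by apply/cyclic_submodP; exists (w * z); rewrite scalerA.
Qed.

(** If a = w b and b = z a, then w z fixes every a_i, hence also e, which is a
    combination of the a_i: so z e is a unit of R e. *)
Lemma cyclic_submod_fiber l e (a : 'rV[R]_l) : e * e = e ->
    a \in gen_rows l e ->
  [set b in gen_rows l e | cyclic_submod b == cyclic_submod a]
    = [set u *: a | u in corner_units e].
Proof.
move=> ee /(gen_rowsP _ ee)[ae [c ec]].
have ea : e *: a = a by apply/rowP=> i; rewrite mxE mulC ae.
apply/setP=> b; apply/setIdP/imsetP=> [[bA /eqP ba] | [u]].
  have /cyclic_submodP[z bz] : b \in cyclic_submod a.
    by rewrite -ba; apply/cyclic_submodP; exists 1; rewrite scale1r.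
  have /cyclic_submodP[w aw] : a \in cyclic_submod b.
    by rewrite ba; apply/cyclic_submodP; exists 1; rewrite scale1r.
  exists (z * e); last by rewrite -scalerA ea.
  apply/corner_unitsP=> //; split; first by rewrite -mulrA ee.
  exists w; rewrite mulrA {1}ec mulr_sumr [RHS]ec.
  apply: eq_bigr => i _; rewrite mulrA [_ * c 0 i]mulC -mulrA; congr (_ * _).
  by rewrite {2}aw bz !mxE mulrA.
case/(corner_unitsP _ ee)=> ue [v vu] ->; split.
  apply/gen_rowsP=> //; split=> [i|]; first by rewrite mxE -mulrA ae.
  exists (v *: c); rewrite {1}ec; apply: eq_bigr => i _; rewrite !mxE.
  rewrite mulrA -[v * _ * u]mulrA [c 0 i * u]mulC mulrA vu [e * _]mulC.
  by rewrite -mulrA [e * _]mulC ae.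
rewrite eqEsubset !cyclic_submod_sub //; apply/cyclic_submodP.
  by exists v; rewrite scalerA vu ea.
by exists u.
Qed.

(** The units of R e act freely on the rows generating R e: if u a = v a then
    u e = v e, again because e is a combination of the a_i. *)
Lemma card_cyclic_submods l e : e * e = e ->
  #|gen_rows l e|
    = (#|[set cyclic_submod a | a in gen_rows l e]| * #|corner_units e|)%N.
Proof.
move=> ee; apply: card_uniform_imset => a aA.
rewrite cyclic_submod_fiber // card_in_imset // => u v.
case/(gen_rowsP _ ee): aA => ae [c ec].
move=> /(corner_unitsP _ ee)[ue _] /(corner_unitsP _ ee)[ve _] /rowP uva.
rewrite -ue -ve {1 2}ec !mulr_sumr; apply: eq_bigr => i _.
by have := uva i; rewrite !mxE => uvi; rewrite ![c 0 i * _]mulC !mulrA uvi.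
Qed.

Lemma card_corner_units_gen_rows e : e * e = e ->
  #|corner_units e| = #|gen_rows 1 e|.
Proof.
move=> ee; pose f u : 'rV[R]_1 := const_mx u.
rewrite -(card_imset (f := f)) => [|u v /rowP/(_ 0)]; last by rewrite !mxE.
apply: eq_card => a; apply/imsetP/gen_rowsP=> // [[u] | [ae [b eb]]].
  case/(corner_unitsP _ ee)=> ue [v vu] ->; split=> [i|]; first by rewrite mxE.
  by exists (const_mx v); rewrite big_ord1 !mxE.
exists (a 0 0); last by apply/rowP=> i; rewrite mxE ord1.
by apply/corner_unitsP=> //; split=> //; exists (b 0 0); rewrite eb big_ord1.
Qed.

(** For e idempotent and nonzero: the ring R e, whose identity is e, is a
    field. *)
Definition corner_field e :=
  forall x, x \in principal e -> x != 0 -> exists y, y * x = e.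

Lemma corner_units_field e : e * e = e -> e != 0 -> corner_field e ->
  corner_units e = principal e :\ 0.
Proof.
move=> ee e0 fe; apply/setP=> u; rewrite in_setD1 mem_principal //.
apply/(corner_unitsP _ ee)/andP=> [[ue [v vu]] | [u0 /eqP ue]].
  split; last exact/eqP.
  by apply: contraNneq e0 => u0; rewrite -vu u0 mulr0.
by split=> //; apply: fe; rewrite // mem_principal ?ue.
Qed.

(** If x ^+ n.+2 = x then x ^+ n.+1 is an idempotent which fixes x and is a
    multiple of x; for x nonzero in R e, primitivity makes it equal to e. *)
Lemma primitive_corner_field e :
  (forall x, exists n, x ^+ n.+2 = x) -> primitive_idempotent e ->
  corner_field e.
Proof.
move=> regR /andP[/andP[e0 /eqP ee] /forallP prim_e] x.
rewrite mem_principal // => /eqP xe x0.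
have [n xn] := regR x; exists (x ^+ n); rewrite -exprSr; set f := x ^+ n.+1.
have ff : f * f = f by rewrite {1}/f exprSr -mulrA -exprS xn -exprSr.
have f0 : f != 0.
  by apply: contraNneq x0 => f0; rewrite -xn exprSr -/f f0 mul0r.
have ef : e * f = f by rewrite mulC /f exprSr -mulrA xe.
have := prim_e f; rewrite /idempotent_elt f0 ff eqxx ef (negPf f0) orbF /=.
by case: eqVneq => // _ /eqP.
Qed.

Lemma primitive_orthogonal e f :
  primitive_idempotent e -> primitive_idempotent f -> e != f -> e * f = 0.
Proof.
move=> /andP[ie /forallP prim_e] /andP[jf /forallP prim_f] ef.
have := prim_e f; rewrite jf eq_sym ef /= => /orP[/eqP efe | /eqP //].
have := prim_f e; rewrite ie ef /= mulC efe => /orP[] eq.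
  by rewrite eq in ef.
by case/andP: ie; rewrite eq.
Qed.

Section OrthogonalDecomposition.

Variables (r : nat) (e_ : 'I_r -> R).
Hypothesis idem : forall j, e_ j * e_ j = e_ j.
Hypothesis orth : forall i j, i != j -> e_ i * e_ j = 0.
Hypothesis neq0 : forall j, e_ j != 0.
Hypothesis field_e : forall j, corner_field (e_ j).

Lemma mul_sum_orthogonal j : (\sum_i e_ i) * e_ j = e_ j.
Proof.
rewrite mulr_suml (bigD1 j) //= big1 ?addr0 // => i; exact: orth.
Qed.

Lemma idem_sum_orthogonal : (\sum_i e_ i) * (\sum_i e_ i) = \sum_i e_ i.
Proof.
by rewrite mulr_sumr; apply: eq_bigr => j _; apply: mul_sum_orthogonal.
Qed.

(** A row a over R e is the sum of its components e_j a.  It generates R e iff no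
    component vanishes: if e_j a = 0 then e_j, a combination of the a_i e_j, is
    0; and a nonzero entry of e_j a is invertible in the field R e_j, which puts
    e_j in the ideal generated by the a_i. *)
Lemma card_gen_rows l :
  #|gen_rows l (\sum_j e_ j)| = \prod_j (#|principal (e_ j)| ^ l).-1%N.
Proof.
set e := \sum_j _; have ee : e * e = e := idem_sum_orthogonal.
pose B j := [set b : 'rV[R]_l | [forall i, b 0 i \in principal (e_ j)]].
have B0 j : 0 \in B j.
  by rewrite inE; apply/forallP=> i; rewrite mxE mem_principal // mul0r.
have cardB j : #|B j :\ 0| = (#|principal (e_ j)| ^ l).-1%N.
  by rewrite -card_rV_in -/(B j) (cardsD1 0 (B j)) B0.
under eq_bigr => j _ do rewrite -cardB.
rewrite -(cardsXn (fun j => B j :\ 0)).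
pose f (a : 'rV[R]_l) : {dffun forall j : 'I_r, 'rV[R]_l} :=
  [ffun j => e_ j *: a].
have fK a : a \in gen_rows l e -> a = \sum_j f a j.
  case/(gen_rowsP _ ee)=> ae _; apply/rowP=> i.
  rewrite -(ae i) summxE mulr_sumr.
  by apply: eq_bigr => j _; rewrite ffunE mxE mulC.
rewrite -[LHS](card_in_imset (f := f)) => [|a b Aa Ab fab]; last first.
  by rewrite (fK a) // fab -fK.
apply: eq_card => b; apply/imsetP/setXnP=> [[a Aa ->] j | Bb].
  have [ae [c ec]] := gen_rowsP _ ee Aa.
  rewrite ffunE in_setD1 inE; apply/andP; split; last first.
    by apply/forallP=> i; rewrite mxE mem_principal // mulC mulrA idem.
  apply: contraNneq (neq0 j) => /rowP ja0.
  rewrite -(mul_sum_orthogonal j) -/e ec mulr_suml big1 // => i _.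
  by have := ja0 i; rewrite !mxE -mulrA [a 0 i * _]mulC => ->; rewrite mulr0.
have bj j i : b j 0 i * e_ j = b j 0 i.
  by case/setD1P: (Bb j) => _; rewrite inE => /forallP/(_ i);
     rewrite mem_principal // => /eqP.
have bij i j k : i != j -> e_ i * b j 0 k = 0.
  by move=> ij; rewrite -bj mulC -mulrA [e_ j * _]mulC orth ?mulr0.
(* The row with prescribed nonzero components b_j is their sum. *)
have fb : b = f (\sum_j b j).
  apply/ffunP=> j; rewrite ffunE scaler_sumr (bigD1 j) //= big1 ?addr0.
    by apply/rowP=> i; rewrite mxE mulC bj.
  by move=> i ij; apply/rowP=> k; rewrite !mxE bij // eq_sym.
exists (\sum_j b j) => //; set a := \sum_j _.
have ba j i : b j 0 i = e_ j * a 0 i by rewrite {1}fb ffunE mxE.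
have /fin_all_exists[c ec] j :
    exists c : 'rV[R]_l, e_ j = \sum_i c 0 i * a 0 i.
  have /rV0Pn[i bji0] : b j != 0 by case/setD1P: (Bb j).
  have [||y yb] := field_e (j := j) (x := b j 0 i) => //.
    by rewrite mem_principal ?bj.
  exists (\row_k if k == i then y * e_ j else 0).
  rewrite (bigD1 i) //= big1 ?addr0 => [|k /negPf ki].
    by rewrite mxE eqxx -mulrA -ba yb.
  by rewrite mxE ki mul0r.
apply/gen_rowsP=> //; split=> [i|].
  rewrite summxE mulr_suml; apply: eq_bigr => j _.
  by rewrite -(bj j) -mulrA [e_ j * e]mulC mul_sum_orthogonal.
exists (\sum_j c j); rewrite /e (eq_bigr _ (fun j _ => ec j)) exchange_big /=.
by apply: eq_bigr => i _; rewrite [(\sum_j c j) 0 i]summxE mulr_suml.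
Qed.

End OrthogonalDecomposition.

End FiniteCommutativeRing.

(** * The group algebra of a finite abelian group *)

Section Monomials.

Variables (F : comNzRingType) (hT : finGroupType).
Implicit Types (a b : F) (h k : hT) (x : {galg F[hT]}).

Definition monomial a h : {galg F[hT]} := [ffun g => a *+ (g == h)].

Lemma monomialX a h n : monomial a h ^+ n = monomial (a ^+ n) (h ^+ n)%g.
Proof.
elim: n => [|n IHn]; first by apply/ffunP=> g; rewrite !ffunE.
rewrite !exprS expgS IHn; apply/ffunP=> g; rewrite galgM (bigD1 h) //= big1.
  by rewrite !ffunE eqxx addr0 mulrnAr (can2_eq (mulKVg h) (mulKg h)).
by move=> k /negPf kh; rewrite ffunE kh mul0r.
Qed.

Lemma galg_monomials x : x = \sum_h monomial (x h) h.
Proof.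
apply/ffunP=> g; rewrite sum_ffunE (bigD1 g) //= big1 ?ffunE ?eqxx ?addr0 //.
by move=> h /negPf; rewrite ffunE eq_sym => ->.
Qed.

End Monomials.

Section RegularGroupAlgebra.

Variables (F : finFieldType) (hT : finGroupType).
Hypothesis abT : abelian [set: hT].
Hypothesis coqT : coprime #|F| #|hT|.

Lemma galg_Frobenius p (x : {galg F[hT]}) : p \in [pchar F] ->
  x ^+ p = \sum_h monomial (x h ^+ p) (h ^+ p)%g.
Proof.
move=> pF; have pR : p \in [pchar {galg F[hT]}].
  rewrite inE (pcharf_prime pF) /= -[_%:R]scaler_nat.
  by rewrite (pcharf0 pF) scale0r eqxx.
rewrite {1}(galg_monomials x) -(pFrobenius_autE pR).
elim/big_rec2: _ => [|h y z _ <-]; first exact: pFrobenius_aut0.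
rewrite pFrobenius_autD_comm; last exact: galgMC.
by rewrite pFrobenius_autE monomialX.
Qed.

(** The p-th power map is injective, so it permutes the finite algebra, and x
    is fixed by its n-th iterate x |-> x ^+ (p ^ n), for n the length of the
    cycle of x. *)
Lemma galg_regular (x : {galg F[hT]}) : exists n, x ^+ n.+2 = x.
Proof.
have [p p_pr pF] := finPcharP F.
have coTp : coprime #|[set: hT]| p.
  rewrite cardsT coprime_sym; apply: coprime_dvdl coqT.
  rewrite (dvdn_pcharf pF) -cardsT.
  exact/eqP/(@expg_cardG _ [set: F]%G 1%R (in_setT _)).
have injX : injective (fun h : hT => h ^+ p)%g.
  by move=> h k /(congr1 (fun h => h ^+ expg_invn [set: hT]%G p)%g);
     rewrite !(expgK coTp) ?inE.
have frobE (y : {galg F[hT]}) h : (y ^+ p) (h ^+ p)%g = y h ^+ p.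
  rewrite galg_Frobenius // sum_ffunE (bigD1 h) //= big1 ?ffunE ?eqxx ?addr0 //.
  by move=> k /negPf kh; rewrite ffunE (inj_eq injX) eq_sym kh.
have injF : injective (fun y : {galg F[hT]} => y ^+ p).
  move=> y z yz; apply/ffunP=> h; apply: (fmorph_inj (pFrobenius_aut pF)).
  by rewrite /= !pFrobenius_autE -!frobE yz.
have iterX n : iter n (fun y : {galg F[hT]} => y ^+ p) x = x ^+ (p ^ n).
  by elim: n => //= n ->; rewrite -exprM -expnSr.
set n := fingraph.order (fun y : {galg F[hT]} => y ^+ p) x.
exists (p ^ n - 2)%N; rewrite -addn2 subnK -?iterX ?iter_order //.
rewrite (leq_trans (prime_gt1 p_pr)) // -{1}[p]expn1 leq_exp2l ?prime_gt1 //.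
exact: fingraph.order_gt0.
Qed.

End RegularGroupAlgebra.

Section PrincipalCard.

Variables (F : finFieldType) (hT : finGroupType).

(** The matrix of right multiplication by x on rows of coefficients. *)
Definition galg_mx (x : {galg F[hT]}) : 'M[F]_#|hT| :=
  \matrix_(i, j) x ((enum_val i)^-1 * enum_val j)%g.

Lemma card_principal_rank (x : {galg F[hT]}) :
  #|principal x| = (#|F| ^ \rank (galg_mx x))%N.
Proof.
pose v (y : {galg F[hT]}) : 'rV[F]_#|hT| := \row_i y (enum_val i).
pose w (b : 'rV[F]_#|hT|) : {galg F[hT]} := [ffun h => b 0 (enum_rank h)].
have vK : cancel v w by move=> y; apply/ffunP=> h; rewrite ffunE mxE enum_rankK.
have wK : cancel w v by move=> b; apply/rowP=> i; rewrite mxE ffunE enum_valK.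
have vM y : v (y * x) = v y *m galg_mx x.
  apply/rowP=> j; rewrite !mxE galgM (reindex (@enum_val hT hT)) /=; last first.
    by exists enum_rank => ? _; rewrite (enum_rankK, enum_valK).
  by apply: eq_bigr => i _; rewrite !mxE.
rewrite -card_rowg -(card_imset _ (can_inj vK)); apply: eq_card => b.
rewrite mem_rowg; apply/imsetP/submxP=> [[_ /imsetP[z _ ->] ->] | [c ->]].
  by exists (v z); rewrite vM.
by exists (w c * x); rewrite ?vM ?wK //; apply/imsetP; exists (w c).
Qed.

Lemma card_principal_dim (x : {galg F[hT]}) :
  #|principal x| = (#|F| ^ \dim <<enum (principal x)>>%VS)%N.
Proof.
rewrite -card_vspace; apply: eq_card => y; apply/idP/idP=> [xy | ].
  by apply: memv_span; rewrite mem_enum.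
move/(@coord_span _ _ _ (in_tuple _))->; elim/big_ind: _ => [|y1 y2|i _].
- by apply/imsetP; exists 0; rewrite ?mul0r.
- case/imsetP=> z1 _ -> /imsetP[z2 _ ->]; apply/imsetP.
  by exists (z1 + z2); rewrite ?mulrDl.
have: (in_tuple (enum (principal x)))`_i \in enum (principal x).
  exact: mem_nth.
rewrite mem_enum => /imsetP[z _ ->]; apply/imsetP.
by exists (coord (in_tuple (enum (principal x))) i y *: z); rewrite ?scalerAl.
Qed.

End PrincipalCard.

(** * Extension of scalars and unit classes *)

Section ScalarExtension.

Variables (F L : finFieldType) (iota : {rmorphism F -> L}) (hT : finGroupType).
Local Notation ext := (@galg_ext F L hT iota).

Lemma galg_extM : {morph ext : x y / x * y}.
Proof.
move=> x y; apply/ffunP=> g; rewrite ffunE !galgM rmorph_sum.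
by apply: eq_bigr => h _; rewrite rmorphM !ffunE.
Qed.

Lemma galg_extB : {morph ext : x y / x - y}.
Proof. by move=> x y; apply/ffunP=> g; rewrite !ffunE rmorphB. Qed.

(** The ideals x F[H] and x L[H] are the row spaces of the same matrix, over F and
    over L, so they have the same dimension over their respective base fields. *)
Lemma card_principal_ext l (x : {galg F[hT]}) : #|L| = (#|F| ^ l)%N ->
  #|principal (ext x)| = (#|principal x| ^ l)%N.
Proof.
move=> cardL; rewrite !card_principal_rank cardL -!expnM mulnC.
suff ->: galg_mx (ext x) = map_mx iota (galg_mx x) by rewrite mxrank_map.
by apply/matrixP=> i j; rewrite !mxE ffunE.
Qed.

Hypothesis abT : abelian [set: hT].
Let mulC (K : comNzRingType) (x y : {galg K[hT]}) : x * y = y * x.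
Proof. exact: galgMC. Qed.

(** The units of the field R e act freely on the nonzero elements of S e: if u and
    v agree on A and u <> v, then u - v is invertible in R e and kills A.  So
    every class has as many elements as there are units. *)
Lemma card_unit_classes l (e : {galg F[hT]}) : #|L| = (#|F| ^ l)%N ->
    e * e = e -> e != 0 -> corner_field e ->
  (#|unit_classes iota e| * #|principal e|.-1)%N = (#|principal e| ^ l).-1%N.
Proof.
move=> cardL ee e0 fe; set D := principal (ext e) :\ 0.
have extee : ext e * ext e = ext e by rewrite -galg_extM ee.
have De A : A \in D -> ext e * A = A.
  by case/setD1P=> _; rewrite mem_principal // mulC => /eqP.
have cuP u := corner_unitsP (@mulC F) u ee.
have uaP A B :
    reflect (exists2 u, u \in corner_units e & A = ext u * B)
            (unit_assoc iota e A B).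
  by apply: (iffP exists_inP) => -[u ue /eqP eqA]; exists u => //; apply/eqP.
have uaS A B : A \in D -> unit_assoc iota e B A -> unit_assoc iota e A B.
  move=> DA /uaP[u /cuP[ue [v vu]] ->]; apply/uaP; exists (v * e).
    apply/cuP; split; first by rewrite -mulrA ee.
    by exists u; rewrite mulrA [u * v]mulC vu ee.
  by rewrite mulrA -galg_extM -mulrA [e * u]mulC ue vu De.
have uaT A B C :
    unit_assoc iota e A B -> unit_assoc iota e B C -> unit_assoc iota e A C.
  move=> /uaP[u /cuP[ue [u' u'u]] ->] /uaP[v /cuP[ve [v' v'v]] ->].
  apply/uaP; exists (u * v); last by rewrite galg_extM mulrA.
  apply/cuP; split; first by rewrite -mulrA ve.
  exists (u' * v'); rewrite -mulrA [u * v]mulC [v' * _]mulrA v'v mulrA.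
  by rewrite -mulrA [e * u]mulC ue.
have eqD : {in D & &, equivalence_rel (unit_assoc iota e)}.
  move=> A B C DA DB DC; split.
    by apply/uaP; exists e; [apply/cuP; split=> //; exists e | rewrite De].
  move=> AB; apply/idP/idP; first by apply: uaT; apply: uaS.
  exact: uaT.
have cardD : #|D| = (#|principal e| ^ l).-1%N.
  rewrite -(card_principal_ext e cardL) (cardsD1 0 (principal (ext e))).
  by rewrite mem_principal // mul0r eqxx.
have cuE := corner_units_field (@mulC F) ee e0 fe.
rewrite -cardD; symmetry.
apply: card_uniform_partition (equivalence_partitionP eqD).
move=> _ /imsetP[A DA ->].
have ->: [set B in D | unit_assoc iota e A B]
    = [set ext u * A | u in corner_units e].
  apply/setP=> B; apply/setIdP/imsetP=> [[DB] | [u ue ->]].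
    by move/uaS=> /(_ DB)/uaP[u ue ->]; exists u.
  have uA : ext u * A \in D.
    case/cuP: (ue) => ueu [v vu]; case/setD1P: (DA) => A0 _.
    rewrite in_setD1 mem_principal // -mulrA [A * _]mulC De // eqxx andbT.
    apply: contraNneq A0 => uA0; rewrite -(De _ DA) -vu galg_extM -mulrA uA0.
    by rewrite mulr0.
  by split=> //; apply: uaS => //; apply/uaP; exists u.
rewrite card_in_imset => [|u v]; last first.
  rewrite cuE => /setD1P[_ ue] /setD1P[_ ve] uv; apply/eqP; rewrite -subr_eq0.
  apply/negPn/negP=> uv0; have [|y ye] := fe _ _ uv0.
    by move: ue ve; rewrite !mem_principal // mulrBl => /eqP-> /eqP->.
  case/setD1P: (DA) => /eqP[]; rewrite -(De _ DA) -ye galg_extM -mulrA.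
  by rewrite galg_extB mulrBl uv subrr mulr0.
by rewrite cuE (cardsD1 0 (principal e)) mem_principal // mul0r eqxx.
Qed.

End ScalarExtension.

(** * Quasi-abelian codes as cyclic submodules *)

Lemma card_subg_type (gT : finGroupType) (H : {group gT}) : #|[subg H]| = #|H|.
Proof.
rewrite -(card_imset _ (@subg_inj _ H)); apply: eq_card => h.
apply/imsetP/idP=> [[x _ ->] | Hh]; first exact: subgP.
by exists (subg H h); rewrite ?subgK.
Qed.

Lemma abelian_subg (gT : finGroupType) (H : {group gT}) :
  abelian [set: gT] -> abelian [set: [subg H]].
Proof.
move=> /centsP cGG; apply/centsP=> x _ y _; apply: subg_inj.
exact: (cGG (sgval x) _ (sgval y)).
Qed.

Section CodesAsSubmodules.

Variables (F : finFieldType) (gT : finGroupType) (H : {group gT}).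
Variables (l : nat) (g : 'I_l -> gT).
Hypothesis hl : l = #|[set: gT] : H|%g.
Hypothesis hg : coset_reps H g.
Local Notation R := {galg F[[subg H]]}.
Local Notation FG := {galg F[gT]}.
Implicit Types (x : R) (c d : FG).

Lemma PhiD : {morph @Phi F gT H l g : c d / c + d}.
Proof.
move=> c d; apply/rowP=> i; rewrite !mxE; apply/ffunP=> h.
by rewrite !ffunE.
Qed.

Lemma PhiM x c : Phi H g (galg_incl x * c) = x *: Phi H g c.
Proof.
apply/rowP=> i; rewrite !mxE; apply/ffunP=> h; rewrite ffunE !galgM.
rewrite (bigID [in H]) /= [X in _ + X]big1 ?addr0 => [|k /negPf Hk]; last first.
  by rewrite ffunE Hk mul0r.
rewrite [LHS](reindex (@sgval _ H)) /=; last first.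
  by exists (subg H) => k Hk; [exact: sgvalK | exact: subgK].
apply: eq_big => [k | k _]; first exact: subgP.
by rewrite !ffunE subgP sgvalK mulgA.
Qed.

Lemma Phi_inj : injective (@Phi F gT H l g).
Proof.
move=> c d /rowP Ecd; apply/ffunP=> t.
have: (H :* t)%g \in [set (H :* g i)%g | i : 'I_l].
  by case: hg => _ ->; apply/rcosetsP; exists t; rewrite ?inE.
case/imsetP=> i _ /rcoset_eqP; rewrite mem_rcoset => Ht.
have := congr1 (fun f : R => f (subg H (t * (g i)^-1)%g)) (Ecd i).
by rewrite !mxE !ffunE subgK // mulgKV.
Qed.

(** Injectivity suffices, both sides having #|F| ^ #|gT| elements by Lagrange. *)
Lemma Phi_bij : bijective (@Phi F gT H l g).
Proof.
apply: inj_card_bij Phi_inj _.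
rewrite card_mx !card_ffun mul1n card_subg_type -expnM hl Lagrange ?subsetT //.
by rewrite cardsT.
Qed.

Lemma Phi_code c :
  Phi H g @: [set galg_incl x * c | x : R] = cyclic_submod (Phi H g c).
Proof.
rewrite /cyclic_submod -imset_comp; apply: eq_imset => x /=; exact: PhiM.
Qed.

Lemma quasi_abelian_code c : quasi_abelian H [set galg_incl x * c | x : R].
Proof.
apply/and3P; split.
- apply/imsetP; exists 0 => //; apply: Phi_inj.
  rewrite PhiM scale0r; apply/rowP=> i; rewrite !mxE; apply/ffunP=> h.
  by rewrite !ffunE.
- apply/forall_inP=> _ /imsetP[x _ ->]; apply/forall_inP=> _ /imsetP[y _ ->].
  apply/imsetP; exists (x + y) => //; apply: Phi_inj.
  by rewrite PhiD !PhiM scalerDl.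
apply/forallP=> y; apply/forall_inP=> _ /imsetP[x _ ->].
apply/imsetP; exists (y * x) => //; apply: Phi_inj.
by rewrite !PhiM scalerA.
Qed.

Lemma Phi_qa_codes (e : R) : idempotent_elt e ->
  [set Phi H g @: (C : {set FG}) | C in qa_codes g e]
    = [set cyclic_submod a | a in gen_rows l e].
Proof.
move=> ie; have [Psi _ PhiK] := Phi_bij.
apply/setP=> M; apply/imsetP/imsetP=> [[C] | [a aA ->]].
  rewrite inE => /and3P[_ _ /existsP[a /and3P[/eqP CPhi _ ea]]] ->.
  by exists a; rewrite ?inE.
exists [set galg_incl x * Psi a | x : R]; last by rewrite Phi_code PhiK.
rewrite inE quasi_abelian_code /=; apply/andP; split.
  by apply/existsP; exists (Psi a).
apply/existsP; exists a; rewrite ie Phi_code PhiK eqxx.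
by move: aA; rewrite inE => ->.
Qed.

Lemma card_qa_codes (e : R) : idempotent_elt e ->
  #|qa_codes g e| = #|[set cyclic_submod a | a in gen_rows l e]|.
Proof.
move=> ie; rewrite -Phi_qa_codes // card_imset //; exact: imset_inj Phi_inj.
Qed.

End CodesAsSubmodules.

(** * Counting codes and unit classes *)

Theorem theorem3p10 (F : finFieldType) (gT : finGroupType) (H : {group gT})
    (abG : abelian [set: gT])
    (coqH : coprime #|F| #|H|)
    (l : nat) (hl : l = #|[set: gT] : H|%g)
    (g : 'I_l -> gT) (hg : coset_reps H g)
    (r : nat) (r_gt0 : (0 < r)%N)
    (e_ : 'I_r -> {galg F[[subg H]]}) (e_inj : injective e_)
    (e_prim : forall j, primitive_idempotent (e_ j)) :
  let q := #|F| in
  let e := \sum_j e_ j in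
  let k j := \dim <<enum (principal (e_ j))>>%VS in
  let CC := qa_codes g e in
  (forall (L : finFieldType) (iota : {rmorphism F -> L}),
     #|L| = (q ^ l)%N ->
     let Omega := setXn (fun j => unit_classes iota (e_ j)) in
     exists f : {dffun forall j : 'I_r, {set {galg L[[subg H]]}}} ->
                {set {galg F[gT]}},
       {in Omega &, injective f} /\ [set f w | w in Omega] = CC) /\
  #|CC|%:R = \prod_j ((q%:R ^+ (l * k j) - 1) / (q%:R ^+ k j - 1)) :> rat.
Proof.
move=> q e k CC.
have abH : abelian [set: [subg H]] by apply: abelian_subg.
have mulC : commutative (@GRing.mul {galg F[[subg H]]}).
  by move=> x y; apply: galgMC.
have regR : forall x : {galg F[[subg H]]}, exists n, x ^+ n.+2 = x.
  by move=> x; apply: galg_regular; rewrite ?card_subg_type.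
have e0 j : e_ j != 0 by case/andP: (e_prim j) => /andP[].
have ee j : e_ j * e_ j = e_ j by case/andP: (e_prim j) => /andP[_ /eqP].
have orth i j : i != j -> e_ i * e_ j = 0.
  by move=> ij; apply: primitive_orthogonal; rewrite ?inj_eq.
have fe j : corner_field (e_ j) by apply: primitive_corner_field.
have eeS : e * e = e by apply: idem_sum_orthogonal.
have ie : idempotent_elt e.
  rewrite /idempotent_elt eeS eqxx andbT; pose j := Ordinal r_gt0.
  apply: contraNneq (e0 j) => eS0.
  by rewrite -(mul_sum_orthogonal ee orth) -/e eS0 mul0r.
pose n j := #|principal (e_ j)|.
have n_gt1 j : (1 < n j)%N.
  rewrite /n (cardsD1 0) mem_principal // mul0r eqxx (cardsD1 (e_ j)).
  by rewrite in_setD1 e0 mem_principal ?ee ?eqxx.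
have n1 j : (0 < (n j).-1)%N by rewrite -subn1 subn_gt0.
(* The units of R e are the rows of length one generating R e. *)
have cardCC : (#|CC| * \prod_j (n j).-1 = \prod_j (n j ^ l).-1)%N.
  rewrite (card_qa_codes hl hg ie) -(card_gen_rows mulC ee orth e0 fe).
  rewrite (card_cyclic_submods mulC _ eeS).
  rewrite (card_corner_units_gen_rows mulC eeS).
  by rewrite (card_gen_rows mulC ee orth e0 fe).
(* Both sets times the number of units of R e count the rows generating R e. *)
split=> [L iota cardL Omega | ].
  apply: (@equicardinal_bij _ _ set0 Omega CC); apply/eqP.
  have P0 : (0 < \prod_j (n j).-1)%N by apply: prodn_gt0.
  rewrite -(eqn_pmul2r P0) cardCC cardsXn -big_split /=; apply/eqP.
  by apply: eq_bigr => j _; apply: card_unit_classes.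
have nq j : n j = (q ^ k j)%N by apply: card_principal_dim.
have natr_pred m : (0 < m)%N -> m.-1%:R = m%:R - 1 :> rat.
  by move=> m0; rewrite -subn1 natrB.
have -> : \prod_j ((q%:R ^+ (l * k j) - 1) / (q%:R ^+ k j - 1))
   = (\prod_j (n j ^ l).-1)%:R / (\prod_j (n j).-1)%:R :> rat.
  rewrite !natr_prod -prodfV -big_split /=; apply: eq_bigr => j _.
  have n0 : (0 < n j)%N by apply: ltnW.
  by rewrite !natr_pred ?expn_gt0 ?n0 // !natrX nq natrX -exprM mulnC.
rewrite -cardCC natrM mulfK // Num.Theory.pnatr_eq0 -lt0n; exact: prodn_gt0.
Qed.
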